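(* The FSR INDECOMPOSABILITY problem is NP-hard: the (NP-complete) CIRCUIT SATISFIABILITY problem is polynomial-time Karp reducible to the problem whose instances are feedback shift registers $f$, given by their feedback logic $f_1$ as a Boolean circuit (input size $|f_1|$), and whose question is ''Is $f$ indecomposable?''.
   Context: A Boolean circuit with $m$ inputs is a directed acyclic graph with $m$ sources (the inputs) and one sink (the output), each non-source vertex being a gate AND or OR (fan-in 2) or NOT (fan-in 1); its size $|f|$ is its number of vertices. It is satisfiable if some input makes it output 1. CIRCUIT SATISFIABILITY: given a Boolean circuit, decide whether it is satisfiable. An $n$-stage feedback shift register (FSR) with feedback logic $f_1:\{0,1\}^n\to\{0,1\}$ has state $(x_0,\dots,x_{n-1})$ updated by $(x_0,\dots,x_{n-1})\mapsto(x_1,\dots,x_{n-1},f_1(x_0,\dots,x_{n-1}))$; its characteristic function is $f(x_0,\dots,x_n)=x_n\oplus f_1(x_0,\dots,x_{n-1})$ and the FSR is identified with $f$. For an $n$-stage FSR $f$ and an $m$-stage FSR $g$ (with $n,m\ge 1$), the product FSR is the $(n+m)$-stage FSR $(f* g)(x_0,\dots,x_{n+m})=f\big(g(x_0,\dots,x_m),g(x_1,\dots,x_{m+1}),\dots,g(x_n,\dots,x_{n+m})\big)$. An FSR $h$ is decomposable if $h=f*g$ for some FSRs $f,g$, and indecomposable otherwise. A decision problem $P$ is polynomial-time Karp reducible to $Q$ if there is a polynomial-time computable map $T$ from instances of $P$ to instances of $Q$ such that $x$ is a yes-instance of $P$ iff $T(x)$ is a yes-instance of $Q$. A problem is NP-hard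 if an NP-complete problem is polynomial-time Karp reducible to it. *)

(* Defs.v *)
From mathcomp Require Import all_boot.
Set Implicit Arguments. Unset Strict Implicit. Unset Printing Implicit Defensive.

(* A circuit with m inputs is represented as a DAG listed in           *)
(* topological order: vertices 0..m-1 are the inputs x_0..x_{m-1},    *)
(* vertex m+i is the i-th gate, whose predecessors are earlier          *)
(* vertices.  The output (sink) is the last vertex.                     *)

Inductive gate : Type :=
| GAnd of nat & nat
| GOr of nat & nat
| GNot of nat.

Record circuit : Type := Circuit { cin : nat; cgates : seq gate }.

Definition csize (C : circuit) : nat := cin C + size (cgates C).

Definition gate_args (g : gate) : seq nat :=
  match g with GAnd j k => [:: j; k] | GOr j k => [:: j; k] | GNot j => [:: j] end.

(* predecessors of a gate at vertex b are earlier vertices; the two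
   in-neighbours of a fan-in-2 gate are distinct vertices (DAG, no
   multi-edges) *)
Definition gate_ok (b : nat) (g : gate) : bool :=
  match g with
  | GAnd j k => [&& j < b, k < b & j != k]
  | GOr j k => [&& j < b, k < b & j != k]
  | GNot j => j < b
  end.

(* well-formed: a DAG with the m inputs as its sources and exactly one
   sink (the last vertex): every other vertex feeds some gate. *)
Definition wf_circuit (C : circuit) : Prop :=
  0 < cin C /\
  (forall i, i < size (cgates C) -> gate_ok (cin C + i) (nth (GNot 0) (cgates C) i)) /\
  (forall v, v < (csize C).-1 ->
     exists2 i, i < size (cgates C) & v \in gate_args (nth (GNot 0) (cgates C) i)).

Definition gate_val (vs : seq bool) (g : gate) : bool :=
  match g with
  | GAnd j k => nth false vs j && nth false vs k
  | GOr j k => nth false vs j || nth false vs k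
  | GNot j => ~~ nth false vs j
  end.

Definition ceval (C : circuit) (x : 'I_(cin C) -> bool) : bool :=
  last false (foldl (fun vs g => rcons vs (gate_val vs g))
                    [seq x i | i <- enum 'I_(cin C)] (cgates C)).

Arguments ceval : clear implicits.

Definition satisfiable (C : circuit) : Prop := exists x, ceval C x.

Definition charfun (n : nat) (f1 : ('I_n -> bool) -> bool) : ('I_n.+1 -> bool) -> bool :=
  fun x => x ord_max (+) f1 (fun i => x (widen_ord (leqnSn n) i)).

Definition fsr_prod (n m : nat) (f : ('I_n.+1 -> bool) -> bool)
    (g : ('I_m.+1 -> bool) -> bool) : ('I_(n + m).+1 -> bool) -> bool :=
  fun x => f (fun i : 'I_n.+1 => g (fun j : 'I_m.+1 => x (inord (i + j)))).

Definition fsr_decomposable (k : nat) (h : ('I_k.+1 -> bool) -> bool) : Prop :=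
  exists n m (f1 : ('I_n -> bool) -> bool) (g1 : ('I_m -> bool) -> bool),
    [/\ 0 < n, 0 < m, n + m = k &
        forall x : 'I_k.+1 -> bool,
          h x = fsr_prod (charfun f1) (charfun g1) (fun i => x (inord i))].

Definition fsr_indecomposable (C : circuit) : Prop :=
  ~ fsr_decomposable (charfun (ceval C)).

(* (numbers in unary; encoding length is polynomially related to |C|) *)

Definition enc_nat (n : nat) : seq bool := rcons (nseq n true) false.

Definition enc_gate (g : gate) : seq bool :=
  match g with
  | GAnd j k => [:: false; false] ++ enc_nat j ++ enc_nat k
  | GOr j k => [:: false; true] ++ enc_nat j ++ enc_nat k
  | GNot j => true :: enc_nat j
  end.

Definition enc_circuit (C : circuit) : seq bool :=
  enc_nat (cin C) ++ flatten [seq enc_gate g | g <- cgates C].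

Inductive move : Type := MLeft | MRight | MStay.

Record TM : Type := {
  tm_state : finType;
  tm_sym : finType;
  tm_blank : tm_sym;
  tm_zero : tm_sym;
  tm_one : tm_sym;
  tm_start : tm_state;
  tm_halt : tm_state;
  tm_delta : tm_state -> tm_sym -> tm_state * tm_sym * move
}.

(* configuration: state, tape left of head (reversed), tape from head on *)
Definition config (M : TM) : Type :=
  (tm_state M * seq (tm_sym M) * seq (tm_sym M))%type.

Definition tm_step (M : TM) (c : config M) : config M :=
  let: (q, l, r) := c in
  if q == tm_halt M then c else
  let a := head (tm_blank M) r in
  let: (q', b, mv) := tm_delta q a in
  let r' := b :: behead r in
  match mv with
  | MStay => (q', l, r')
  | MRight => (q', b :: l, behead r')
  | MLeft => (q', behead l, head (tm_blank M) l :: r')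
  end.

Definition tm_init (M : TM) (x : seq bool) : config M :=
  (tm_start M, [::], [seq if b then tm_one M else tm_zero M | b <- x]).

Fixpoint read_bits (M : TM) (r : seq (tm_sym M)) : seq bool :=
  match r with
  | [::] => [::]
  | a :: r' => if a == tm_one M then true :: read_bits r'
               else if a == tm_zero M then false :: read_bits r'
               else [::]
  end.

(* M, started on input x, halts within t steps with output y
   (the maximal bit string starting at the head position) *)
Definition tm_outputs_within (M : TM) (x : seq bool) (t : nat) (y : seq bool) : Prop :=
  exists2 k, k <= t &
    let: (q, _, r) := iter k (@tm_step M) (tm_init M x) in
    q = tm_halt M /\ read_bits r = y.

Definition tm_wf (M : TM) : Prop :=
  [/\ tm_blank M != tm_zero M, tm_blank M != tm_one M & tm_zero M != tm_one M].

Definition polytime_circuit_map (T : circuit -> circuit) : Prop :=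
  exists (M : TM) (c d : nat), tm_wf M /\
    forall C, wf_circuit C ->
      tm_outputs_within M (enc_circuit C) (c * (size (enc_circuit C)) ^ d + c)
                        (enc_circuit (T C)).

Definition karp_reduction_CSAT_to_FSRIndec (T : circuit -> circuit) : Prop :=
  polytime_circuit_map T /\
  forall C, wf_circuit C ->
    wf_circuit (T C) /\ (satisfiable C <-> fsr_indecomposable (T C)).

(* Main.v *)
(** From a circuit [C] with [p] inputs build the feedback logic
      h1 = x_0 /\ (~ x_1 \/ x_{p+2}) /\ C (~ x_2, .., ~ x_{p+1})
    with [k = p + 3] stages.  If [C] is unsatisfiable, then [h1 = 0] and [x_k] is the product
    of two shifts.  Suppose that [C] is satisfiable and that [h] is a product of stages [n]
    and [m].  With [y_i = g (x_i, .., x_{i+m})] we get h1 = g1 (x_n, ..) + f1 (y_0, .., y_{n-1}),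
    and only [y_0] depends on [x_0].  As [h1] vanishes at [x_0 = 0], at [x_0 = 1] it is
    r (x_1, .., x_{m-1}) /\ s (y_1, .., y_{n-1}).  Once [x_1, .., x_{m-1}] are fixed, the map
    from (x_m, .., x_{k-1}) to (x_m, y_1, .., y_{n-1}) is bijective, so every prefix that
    extends to a solution has equally many completions; but below a prefix with [x_1 = 1] the
    last input is forced to be 1, while below the same prefix with [x_1 = 0] it is free.  This
    settles [m > 1]; for [m = 1] the [y_i] are differences of neighbours, up to a constant, and
    complementing all inputs gives the contradiction.

    The reduction is computed by a Turing machine that simulates a queue: a symbol popped at
    the front makes a finite transducer push a word at the back.  Each pass over the queue
    counts one input or one gate of [C] and lengthens the unary references accordingly. *)
Require Import Defs.
From mathcomp Require Import all_boot zify.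
From HB Require Import structures.
From Stdlib Require Import FunctionalExtensionality.
Set Implicit Arguments. Unset Strict Implicit. Unset Printing Implicit Defensive.

(** * Products of feedback shift registers *)

Definition block (m : nat) (g1 : ('I_m -> bool) -> bool) (X : nat -> bool) (i : nat) : bool :=
  X (i + m) (+) g1 (fun j : 'I_m => X (i + j)).

(** Block [n] of the product contributes x_{n+m} = x_k, which cancels against the linear term of
    [charfun h1]. Taking the inputs from a sequence on [nat] removes the casts between ordinals. *)
Lemma fsr_decomposable_seq k (h1 : ('I_k -> bool) -> bool) :
  fsr_decomposable (charfun h1) ->
  exists n m (f1 : ('I_n -> bool) -> bool) (g1 : ('I_m -> bool) -> bool),
    [/\ 0 < n, 0 < m, n + m = k & forall X : nat -> bool,
      h1 (fun i => X i) =
        g1 (fun j => X (n + j)) (+) f1 (fun i => block g1 X i)].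
Proof.
case=> n [m [f1 [g1 [n_gt0 m_gt0 nmk hE]]]]; exists n, m, f1, g1; split=> // X.
have blockE i : i <= n ->
    charfun g1 (fun j => X (@inord k (@inord (n + m) (i + j)))) = block g1 X i.
  move=> le_in; rewrite /charfun /block.
  have inE j : j <= m -> X (@inord k (@inord (n + m) (i + j))) = X (i + j).
    by move=> le_jm; rewrite !inordK // ltnS -?nmk leq_add.
  rewrite inE //; congr (_ (+) g1 _); apply: functional_extensionality => j /=.
  by rewrite inE // ltnW.
have fE : (fun i : 'I_n => charfun g1 (fun j => X (@inord k (@inord (n + m) (i + j))))) =
    (fun i => block g1 X i).
  by apply: functional_extensionality => i; apply/blockE/ltnW.
have := hE (fun i => X i); rewrite /fsr_prod {1 2}/charfun /= fE blockE //.
by rewrite {1}/block nmk -addbA => /addbI.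
Qed.

Lemma fsr_decomposable0 k (h1 : ('I_k -> bool) -> bool) :
  1 < k -> (forall x, ~~ h1 x) -> fsr_decomposable (charfun h1).
Proof.
case: k h1 => [|[|k]] // h1 _ h1F.
exists 1, k.+1, (fun _ => false), (fun _ => false); split=> // x.
rewrite /fsr_prod /charfun !addbF (negbTE (h1F _)) addbF; congr x.
by apply: val_inj; rewrite /= add1n !inordK ?ltnS ?addn0 //= inordK.
Qed.

(** * Indecomposability of the gadget *)

Section Gadget.

Variables (p : nat) (h1 : ('I_p.+3 -> bool) -> bool) (Q : ('I_p -> bool) -> bool).
Hypothesis h1E : forall X : nat -> bool,
  h1 (fun i => X i) = [&& X 0, ~~ X 1 || X p.+2 & Q (fun i => X i.+2)].

Variable y : 'I_p -> bool.
Hypothesis Qy : Q y.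

Let Y (v : bool) (i : nat) : bool :=
  if i < 2 then true else if i == p.+2 then v else nth false [seq y j | j <- enum 'I_p] (i - 2).

Let QY v : Q (fun i : 'I_p => Y v i.+2) = Q y.
Proof.
congr Q; apply: functional_extensionality => i; rewrite /Y /= !eqSS ltn_eqF //.
by rewrite subn2 /= (nth_map i) ?size_enum_ord // nth_ord_enum.
Qed.

Let YE v i : i != p.+2 -> Y v i = Y true i.
Proof. by rewrite /Y => /negbTE->. Qed.

Let Ylast v : Y v p.+2 = v. Proof. by rewrite /Y /= eqxx. Qed.

Lemma gadget_not_wide n m (f1 : ('I_n -> bool) -> bool) (g1 : ('I_m -> bool) -> bool) :
  0 < n -> 1 < m -> n + m = p.+3 ->
  ~ (forall X : nat -> bool, h1 (fun i => X i) =
       g1 (fun j => X (n + j)) (+) f1 (fun i => block g1 X i)).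
Proof.
move=> n_gt0 m_gt1 nmp hE; have m_gt0 := ltnW m_gt1.
pose o : 'I_n := Ordinal n_gt0.
(* x_2 .. x_{m-1} come from [Y], and x_m .. x_{k-1} from [t]. As m <= p+2, the last input always
   lies in [t]; as m > 1, x_1 never does. *)
pose pt b0 b1 (t : {ffun 'I_n -> bool}) i :=
  if i == 0 then b0 else if i == 1 then b1 else
  if i < m then Y true i else t (insubd o (i - m)).
have ptE b0 b1 t i (lt_in : i < n) : pt b0 b1 t (i + m) = t (Ordinal lt_in).
  rewrite /pt addn_eq0 (gtn_eqF m_gt0) andbF gtn_eqF ?(leq_trans m_gt1) ?leq_addl //.
  rewrite ltnNge leq_addl /= addnK; congr (t _); apply: val_inj.
  by rewrite val_insubd lt_in.
have ptS b0 b0' b1 t i : 0 < i -> pt b0 b1 t i = pt b0' b1 t i by case: i.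
pose tl v := [ffun i : 'I_n => Y v (i + m)].
have pt_tl b0 b1 v i : 1 < i < p.+3 -> pt b0 b1 (tl v) i = Y v i.
  case/andP=> i_gt1 i_lt; case: (ltnP i m) => [lt_im | le_mi].
    rewrite /pt gtn_eqF ?(ltnW i_gt1) // gtn_eqF // lt_im YE //.
    by rewrite ltn_eqF // (leq_trans lt_im) // -ltnS -nmp -addn1 addnC leq_add2r.
  have lt_in : i - m < n by rewrite ltn_subLR // addnC nmp.
  by rewrite -(subnK le_mi) (ptE _ _ _ _ lt_in) ffunE.
have h1pt b0 b1 v : h1 (fun i => pt b0 b1 (tl v) i) = b0 && (~~ b1 || v).
  rewrite h1E (pt_tl _ _ _ p.+2) ?ltnSn // Ylast -[RHS]andbT -Qy -(QY v) -andbA.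
  congr [&& _, _ & Q _]; apply: functional_extensionality => i.
  by rewrite pt_tl // !ltnS /= ltnW.
(* The map from (x_m, .., x_{k-1}) to (x_m, y_1, .., y_{n-1}). The blocks y_i with i > 0 do not see
   x_0, which may thus be set to [false]. *)
pose Phi b (t : {ffun 'I_n -> bool}) : {ffun 'I_n -> bool} :=
  [ffun i : 'I_n => if i == o then t i else block g1 (pt false b t) i].
(* The system is triangular: y_i is x_{i+m} plus a function of earlier entries, so [t] is recovered
   by strong induction. *)
have PhiI b : injective (Phi b).
  move=> t t' /ffunP eq_tt'; apply/ffunP=> i.
  case: i; elim/ltn_ind=> i IH lt_in.
  have := eq_tt' (Ordinal lt_in); rewrite !ffunE.
  case: ifP => // _; rewrite /block !ptE.
  set a := g1 _; set a' := g1 _; suff -> : a = a' by move/addIb.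
  congr g1; apply: functional_extensionality => j.
  case: (ltnP (i + j) m) => [lt_ijm | le_mij].
    by rewrite /pt lt_ijm.
  have lt_iji : i + j - m < i by rewrite ltn_subLR // addnC ltn_add2r.
  rewrite -(subnK le_mij) !(ptE _ _ _ _ (ltn_trans lt_iji lt_in)); exact: IH.
(* [s] is the derivative of [f1] in its first argument y_0. *)
pose s (u : {ffun 'I_n -> bool}) :=
  f1 (fun i => if i == o then true else u i)
  (+) f1 (fun i => if i == o then false else u i).
pose rho b0 b := g1 (fun j : 'I_m => pt b0 b (tl true) j).
have block0 b0 b t : block g1 (pt b0 b t) 0 = t o (+) rho b0 b.
  rewrite /block (ptE _ _ _ _ n_gt0); congr (_ (+) g1 _).
  by apply: functional_extensionality => j; rewrite /pt add0n ltn_ord.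
have blockS b0 b t (i : 'I_n) : i != o -> block g1 (pt b0 b t) i = Phi b t i.
  move=> i_neq; have i_gt0 : 0 < i by rewrite lt0n.
  rewrite ffunE (negbTE i_neq) /block (ptS b0 false) ?addn_gt0 ?i_gt0 //.
  congr (_ (+) g1 _); apply: functional_extensionality => j.
  by rewrite (ptS b0 false) // addn_gt0 i_gt0.
(* Add the equation at x_0 = 0, where [h1] vanishes; the [g1] term reads from index n > 0 on and
   cancels. *)
have h1f1 b t : h1 (fun i => pt true b t i) =
    f1 (fun i => block g1 (pt true b t) i) (+) f1 (fun i => block g1 (pt false b t) i).
  have h0 : h1 (fun i => pt false b t i) = false by rewrite h1E.
  rewrite -[LHS]addbF -[X in _ (+) X]h0 !hE addbACA -[RHS]addFb; congr (_ (+) _).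
  rewrite -[RHS](addbb (g1 (fun j => pt true b t (n + j)))); congr (_ (+) g1 _).
  by apply: functional_extensionality => j; apply: ptS; rewrite addn_gt0 n_gt0.
(* If flipping x_0 left y_0 unchanged, no block would change, and [h1f1] would give 0 at the
   solution with x_{p+2} = 1. *)
have rhoN b : rho true b = ~~ rho false b.
  have [eq_rho|] := eqVneq (rho true b) (rho false b); last by do 2!case: (rho _ b).
  have := h1pt true b true; rewrite h1f1 orbT.
  suff -> : (fun i : 'I_n => block g1 (pt true b (tl true)) i) =
            (fun i : 'I_n => block g1 (pt false b (tl true)) i) by rewrite addbb.
  apply: functional_extensionality => i.
  by have [-> | i_neq] := eqVneq i o; [rewrite !block0 eq_rho | rewrite !blockS].
have h1s b t : h1 (fun i => pt true b t i) = s (Phi b t).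
  have f1E b0 : f1 (fun i => block g1 (pt b0 b t) i) =
      f1 (fun i => if i == o then t o (+) rho b0 b else Phi b t i).
    congr f1; apply: functional_extensionality => i.
    by case: eqVneq => [-> | i_neq]; rewrite ?block0 ?blockS.
  by rewrite h1f1 !f1E rhoN /s; case: (t o) (rho false b) => [] [] //=; rewrite addbC.
pose Sol b := [set t | h1 (fun i => pt true b t i)].
(* [Phi b] is an injection of a finite set into itself, so taking preimages keeps cardinality,
   whatever [b] is. *)
have cardSol b : #|Sol b| = #|[set u | s u]|.
  rewrite -[RHS](card_preimset _ (@PhiI b)); apply: eq_card => t.
  by rewrite !inE h1s.
(* Setting x_1 = 1 only adds the demand x_{p+2} = 1, and [tl false] is a solution for x_1 = 0 that
   violates it. *)
have : Sol true \proper Sol false.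
  apply/properP; split; last by exists (tl false); rewrite inE h1pt.
  apply/subsetP=> t; rewrite !inE !h1E => /and3P[_ _ Qt]; apply/and3P; split=> //.
by move/proper_card; rewrite !cardSol ltnn.
Qed.

Lemma gadget_not_narrow n (f1 : ('I_n -> bool) -> bool) (g1 : ('I_1 -> bool) -> bool) :
  n = p.+2 ->
  ~ (forall X : nat -> bool, h1 (fun i => X i) =
       g1 (fun j => X (n + j)) (+) f1 (fun i => block g1 X i)).
Proof.
move=> np hE; pose c b := g1 (fun _ => b).
have {}hE (X : nat -> bool) :
    h1 (fun i => X i) = c (X n) (+) f1 (fun i : 'I_n => X i.+1 (+) c (X i)).
  rewrite hE; congr (g1 _ (+) f1 _); apply: functional_extensionality => i.
    by rewrite ord1 addn0.
  rewrite /block addn1; congr (_ (+) g1 _).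
  by apply: functional_extensionality => j; rewrite ord1 addn0.
pose Z b v i := if i == 0 then b else Y v i.
(* [Z'] is the complement of [Z true false]. [h1] vanishes at both: here since x_0 = 0, there since
   x_1 = 1 and x_{p+2} = 0. *)
pose Z' i := (i != 0) && ~~ Y false i.
have h1Z b v : h1 (fun i => Z b v i) = b && v.
  by rewrite h1E /Z /= Ylast QY Qy andbT.
have h1Z' : h1 (fun i => Z' i) = false by rewrite h1E.
(* If [c] is constant, the right-hand side does not depend on x_0, while [h1] does. *)
have [cE | cN] := eqVneq (c true) (c false).
  have cC b : c b = c false by case: b.
  have := h1Z true true; rewrite -(addbF (h1 _)) -[X in _ (+) X](h1Z false true) !hE !cC.
  set u := f1 _; set u' := f1 _; suff -> : u = u' by rewrite addbb.
  by congr f1; apply: functional_extensionality => i; rewrite !cC.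
have {cN} cN b : c (~~ b) = ~~ c b.
  by case: b; move: cN; case: (c true) (c false) => [] [].
(* Now [c] commutes with negation, so complementing all inputs preserves every x_{i+1} + c(x_i) but
   flips c(x_n). *)
have : h1 (fun i => Z true false i) = h1 (fun i => Z' i) by rewrite h1Z h1Z'.
rewrite !hE.
set u := f1 _; set u' := f1 _; suff -> : u = u'.
  by move/addIb; rewrite /Z /Z' np /= cN; case: (c _).
have addNN a b : a (+) b = ~~ a (+) ~~ b by case: a b => [] [].
congr f1; apply: functional_extensionality => i; rewrite /Z /Z' /=.
by case: (nat_of_ord i) => [|j]; [rewrite /= -cN | rewrite /= addNN -cN].
Qed.

Lemma gadget_indecomposable : ~ fsr_decomposable (charfun h1).
Proof.
case/fsr_decomposable_seq=> n [[|[|m]] [f1 [g1 [n_gt0 // _ nmp]]]].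
- by apply: gadget_not_narrow; apply: succn_inj; rewrite -addn1.
- exact: gadget_not_wide.
Qed.

End Gadget.

(** * The circuit reduction *)

Definition shift_gate d g :=
  match g with
  | GAnd j k => GAnd (d + j) (d + k)
  | GOr j k => GOr (d + j) (d + k)
  | GNot j => GNot (d + j)
  end.

(* With [p = cin C], the inputs are [x_0], [x_1], [z_0 .. z_{p-1}], [x_{p+2}].
   Feeding [C] with the [p] fresh vertices [~ z_j] makes all references of [C],
   to inputs and to gates alike, move by the same amount [p + 6]. *)
Definition reduction C :=
  let p := cin C in
  Circuit p.+3
    ([:: GNot 1; GOr p.+3 p.+2; GAnd 0 p.+4] ++ [seq GNot i.+2 | i <- iota 0 p] ++
     [seq shift_gate (p + 6) g | g <- cgates C] ++ [:: GAnd (p + 5) (p + 5 + csize C)]).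

Definition eval_gates := foldl (fun vs g => rcons vs (gate_val vs g)).

Lemma size_eval_gates vs gs : size (eval_gates vs gs) = size vs + size gs.
Proof. by elim: gs vs => [|g gs IH] vs /=; rewrite ?addn0 // IH size_rcons addSnnS. Qed.

Lemma eval_gates_cat vs gs1 gs2 :
  eval_gates vs (gs1 ++ gs2) = eval_gates (eval_gates vs gs1) gs2.
Proof. exact: foldl_cat. Qed.

Lemma eval_gates_shift pre vs gs :
  eval_gates (pre ++ vs) [seq shift_gate (size pre) g | g <- gs] = pre ++ eval_gates vs gs.
Proof.
have nthE vs' j : nth false (pre ++ vs') (size pre + j) = nth false vs' j.
  by rewrite nth_cat ltnNge leq_addr addKn.
elim: gs vs => //= g gs IH vs; rewrite rcons_cat IH; congr (_ ++ eval_gates (rcons _ _) _).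
by case: g => * /=; rewrite !nthE.
Qed.

Lemma eval_gates_not vs js : all (fun j => j < size vs) js ->
  eval_gates vs [seq GNot j | j <- js] = vs ++ [seq ~~ nth false vs j | j <- js].
Proof.
elim/last_ind: js => [|js j IH]; first by rewrite cats0.
rewrite all_rcons => /andP[lt_j /IH {}IH]; rewrite !map_rcons -cats1 eval_gates_cat IH /=.
by rewrite -rcons_cat nth_cat lt_j.
Qed.

Lemma ceval_seq C (X : nat -> bool) :
  ceval C (fun i => X i) = last false (eval_gates [seq X i | i <- iota 0 (cin C)] (cgates C)).
Proof. by rewrite /ceval -val_enum_ord -map_comp. Qed.

(** Vertex p+5 carries x_0 /\ (~ x_1 \/ x_{p+2}), and vertex p+6+v the value of vertex v of [C],
    whose output is therefore at p+5+[csize C]. *)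
Lemma ceval_reduction C (X : nat -> bool) : 0 < cin C ->
  ceval (reduction C) (fun i => X i) =
    [&& X 0, ~~ X 1 || X (cin C).+2 & ceval C (fun i => ~~ X i.+2)].
Proof.
move=> p_gt0; rewrite (ceval_seq C (fun i => ~~ X i.+2)) ceval_seq.
rewrite [cin (reduction C)]/=; set p := cin C in p_gt0 *.
set vs0 := [seq X i | i <- iota 0 p.+3].
have nth0 i : i < p.+3 -> nth false vs0 i = X i.
  by move=> lt_i; rewrite (nth_map 0) ?size_iota // nth_iota.
have sz0 : size vs0 = p.+3 by rewrite size_map size_iota.
move: vs0 nth0 sz0 => vs0 nth0 sz0.
pose a := ~~ X 1 || X p.+2.
have -> : eval_gates vs0 (cgates (reduction C)) =
    eval_gates (vs0 ++ [:: ~~ X 1; a; X 0 && a]) (behead (behead (behead (cgates (reduction C))))).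
  rewrite /eval_gates [LHS]/= -/p -!cats1 -!catA [RHS]/= -/p; congr foldl.
  rewrite /= !nth_cat sz0 !ltnn !subnn ltnSn [p.+4 < _]ltnNge leqnSn subSnn.
  by rewrite (nth0 0) // (nth0 1) // (nth0 p.+2).
rewrite [behead _]/= -/p.
set vs1 := vs0 ++ _.
have sz1 : size vs1 = p + 6 by rewrite size_cat sz0 /=; lia.
have -> : [seq GNot i.+2 | i <- iota 0 p] = [seq GNot j | j <- [seq i.+2 | i <- iota 0 p]].
  by rewrite -map_comp.
rewrite eval_gates_cat eval_gates_not; last first.
  by apply/allP=> _ /mapP[i + ->]; rewrite mem_iota sz1 => /andP[_]; lia.
rewrite -map_comp /= -sz1 eval_gates_cat eval_gates_shift /=.
have -> : [seq ~~ nth false vs1 i.+2 | i <- iota 0 p] = [seq ~~ X i.+2 | i <- iota 0 p].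
  apply/eq_in_map => i; rewrite mem_iota => /andP[_ lt_ip].
  by rewrite nth_cat sz0 nth0 ?ifT //; lia.
set vs := eval_gates _ _.
have szvs : size vs = csize C by rewrite size_eval_gates size_map size_iota.
rewrite last_rcons !nth_cat -szvs; have -> : p + 5 < size vs1 by lia.
have s_gt0 : 0 < size vs by rewrite szvs ltn_addr.
have -> : (p + 5 + size vs < size vs1) = false by lia.
have -> : p + 5 + size vs - size vs1 = (size vs).-1 by lia.
rewrite nth_last ltnNge sz0; have -> : p.+3 <= p + 5 by lia.
have -> : p + 5 - p.+3 = 2 by lia.
by rewrite /= -andbA.
Qed.

Lemma satisfiable_reduction C : 0 < cin C ->
  satisfiable C <-> fsr_indecomposable (reduction C).
Proof.
move=> p_gt0; split=> [[y Cy] | indec].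
  (* The gadget contains [C] on negated inputs, so the complement of [y] solves it. *)
  apply: (@gadget_indecomposable _ _ (fun u => ceval C (fun i => ~~ u i)) _ (fun i => ~~ y i)).
    by move=> X; exact: ceval_reduction.
  have yE : (fun i => ~~ ~~ y i) = y by apply: functional_extensionality => i; rewrite negbK.
  by rewrite yE.
case: (pickP (fun t : {ffun 'I_(cin C) -> bool} => ceval C t)) => [t Ct | unsat].
  by exists t.
case: indec; apply: fsr_decomposable0 => // x.
have -> : x = (fun i : 'I_(cin C).+3 => x (inord i)).
  by apply: functional_extensionality => i; rewrite inord_val.
rewrite (ceval_reduction (fun i => x (inord i))) //; apply/negP => /and3P[_ _].
have := unsat [ffun i : 'I_(cin C) => ~~ x (inord i.+2)]; set u := fun_of_fin _.
suff -> : u = (fun i : 'I_(cin C) => ~~ x (inord i.+2)) by move->.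
by apply: functional_extensionality => i; rewrite /u ffunE.
Qed.

(** * Well-formedness of the constructed circuit *)

Fixpoint gates_ok b gs := if gs is g :: gs' then gate_ok b g && gates_ok b.+1 gs' else true.

Lemma gates_okP b gs :
  reflect (forall i, i < size gs -> gate_ok (b + i) (nth (GNot 0) gs i)) (gates_ok b gs).
Proof.
elim: gs b => [|g gs IH] b /=; first by constructor.
apply: (iffP andP) => [[okg /IH okgs] [|i] lt_i | ok].
- by rewrite addn0.
- by rewrite addnS; exact: okgs.
- split; first by rewrite -[b]addn0; exact: ok 0 _.
  by apply/IH=> i lt_i; rewrite addSnnS; exact: ok i.+1 _.
Qed.

Lemma gates_ok_cat b gs1 gs2 :
  gates_ok b (gs1 ++ gs2) = gates_ok b gs1 && gates_ok (b + size gs1) gs2.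
Proof.
by elim: gs1 b => [|g gs1 IH] b /=; rewrite ?addn0 // IH andbA addSnnS.
Qed.

Lemma gates_ok_shift d b gs :
  gates_ok (d + b) [seq shift_gate d g | g <- gs] = gates_ok b gs.
Proof.
elim: gs b => //= g gs IH b; rewrite -addnS IH; congr andb.
by case: g => * /=; rewrite ?ltn_add2l ?eqn_add2l.
Qed.

Lemma gates_ok_not b js : all (fun j => j < b) js -> gates_ok b [seq GNot j | j <- js].
Proof.
elim: js b => //= j js IH b /andP[-> lt_js]; apply: IH.
by apply: sub_all lt_js => i /ltnW.
Qed.

Lemma gate_args_shift d g : gate_args (shift_gate d g) = [seq d + j | j <- gate_args g].
Proof. by case: g. Qed.

Lemma wf_reduction C : wf_circuit C -> wf_circuit (reduction C).
Proof.
case=> p_gt0 [/gates_okP okC useC]; set p := cin C in p_gt0 okC.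
have nots : [seq GNot i.+2 | i <- iota 0 p] = [seq GNot j | j <- iota 2 p].
  by rewrite (iotaDl 2 0) -map_comp.
split=> //; split.
  apply/gates_okP; rewrite /reduction -/p /= !gates_ok_cat nots !size_map !size_iota.
  have -> : p.+3.+3 + p = p + 6 + p by lia.
  rewrite gates_ok_shift okC /csize -/p /= gates_ok_not ?andbT; last first.
    by apply/allP=> j; rewrite mem_iota; lia.
  by apply/and3P; split; try lia; apply/and3P; split; lia.
move=> v lt_v; apply/(has_nthP (a := fun g => v \in gate_args g) (GNot 0)).
rewrite /reduction -/p !has_cat nots.
have {lt_v} lt_v : v < p + 6 + csize C.
  by move: lt_v; rewrite /csize /reduction -/p /= !(size_cat, size_map, size_iota) /=; lia.
(* Below p+5, vertices 2 .. p+1 feed the negations and the remaining ones the first three gates.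
   Vertex p+5 and the sink of [C] feed the last gate; any other vertex of [C] feeds a gate of
   [C]. *)
have [lt_vp|] := ltnP v (p + 5).
  have [/andP[v_gt1 lt_v2]|] := boolP (1 < v < p.+2).
    apply/or3P; apply: Or32; rewrite has_map; apply/hasP; exists v; last exact: mem_head.
    by rewrite mem_iota; lia.
  by move=> v_out; apply/orP; left; rewrite /= !inE; lia.
rewrite leq_eqVlt => /orP[/eqP <-|lt5v]; first by rewrite /= !inE eqxx !orbT.
have [d dE] : exists d, v = p + 6 + d by exists (v - (p + 6)); lia.
have [lt_d|ge_d] := ltnP d (csize C).-1.
  have [i lt_i d_in] := useC d lt_d; apply/or4P; apply: Or43; rewrite has_map.
  apply/(has_nthP (GNot 0)); exists i => //=.
  by rewrite gate_args_shift dE map_f.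
by apply/or4P; apply: Or44; rewrite /= !inE; lia.
Qed.

(** * Turing machines simulating queues *)

Section Sweep.

Variables (Q A : finType) (blank zero one hash : A) (q0 qh : Q).
Variables (N : nat) (tr : Q -> A -> Q * seq A).

(* The queue is the word between blanks.  In state [Main q] the head is on its front symbol;
   [Put q a i] has popped [a] in state [q], moves to the end of the queue and writes the
   symbols of [(tr q a).2] from the [i]-th on; [Back q] returns to the front.  [Init] first
   appends the end marker [hash] to the input. *)
Definition sweep_state : Type := (bool + (Q + Q + Q * A * 'I_N.+1))%type.

Definition Init : sweep_state := inl false.
Definition Halt : sweep_state := inl true.
Definition Main q : sweep_state := inr (inl (inl q)).
Definition Back q : sweep_state := inr (inl (inr q)).
Definition Put q a i : sweep_state := inr (inr (q, a, inord i)).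

Definition sweep_delta (s : sweep_state) (b : A) : sweep_state * A * move :=
  match s with
  | inl false => if b == blank then (Back q0, hash, MLeft) else (Init, b, MRight)
  | inl true => (Halt, b, MStay)
  | inr (inl (inl q)) => if q == qh then (Halt, b, MStay) else (Put q b 0, blank, MRight)
  | inr (inl (inr q)) => if b == blank then (Main q, blank, MRight) else (Back q, b, MLeft)
  | inr (inr (q, a, i)) =>
      if b != blank then (s, b, MRight)
      else if i < size (tr q a).2 then (Put q a i.+1, nth blank (tr q a).2 i, MRight)
      else (Back (tr q a).1, blank, MLeft)
  end.

Definition sweep_TM : TM :=
  Build_TM blank zero one Init Halt sweep_delta.

Local Notation step := (@tm_step sweep_TM).
Local Notation conf s l r := ((s, l, r) : config sweep_TM).
Local Notation blanks j := (nseq j blank).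

Definition reaches (t : nat) (c c' : config sweep_TM) := exists2 k, k <= t & iter k step c = c'.

Lemma reaches_refl c : reaches 0 c c. Proof. by exists 0. Qed.

Lemma reaches_trans t1 t2 c1 c2 c3 :
  reaches t1 c1 c2 -> reaches t2 c2 c3 -> reaches (t1 + t2) c1 c3.
Proof.
by case=> k1 le1 <- [k2 le2 <-]; exists (k2 + k1); rewrite ?iterD // addnC leq_add.
Qed.

Lemma reaches_step t c1 c2 : reaches t (step c1) c2 -> reaches t.+1 c1 c2.
Proof. by case=> k le_kt <-; exists k.+1; rewrite // iterSr. Qed.

Lemma reaches_le t t' c1 c2 : t <= t' -> reaches t c1 c2 -> reaches t' c1 c2.
Proof. by move=> le_tt' [k le_kt <-]; exists k; rewrite // (leq_trans le_kt). Qed.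

Local Notation nonblank := (all (fun a => a != blank)).

Lemma head_blanks j : head blank (blanks j) = blank. Proof. by case: j. Qed.

Lemma behead_blanks j : behead (blanks j) = blanks j.-1. Proof. by case: j. Qed.

Definition go_left q l r := conf (Back q) (behead l) (head blank l :: r).

(** The walk ends on a blank left of [u], supplied from beyond the listed tape if j = 0; the step
    back to the right lists it, whence [j.-1.+1]. *)
Lemma step_back q u r j : nonblank u ->
  reaches (size u).+1 (go_left q (rev u ++ blanks j) r) (conf (Main q) (blanks j.-1.+1) (u ++ r)).
Proof.
elim/last_ind: u r => [|u a IH] r.
  move=> _; apply: reaches_step; rewrite /go_left /tm_step /=.
  by rewrite head_blanks behead_blanks eqxx; exact: reaches_refl.
rewrite all_rcons => /andP[a_nb /IH{}IH]; rewrite size_rcons.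
apply: reaches_step; rewrite /go_left rev_rcons /= /tm_step /= (negbTE a_nb) -cats1 -catA.
exact: IH.
Qed.

Lemma step_right s l u r :
  (forall b, b != blank -> sweep_delta s b = (s, b, MRight)) -> s != Halt -> nonblank u ->
  reaches (size u) (conf s l (u ++ r)) (conf s (rev u ++ l) r).
Proof.
move=> s_right sNH; elim: u l => [|a u IH] l /=; first by move=> _; exact: reaches_refl.
case/andP=> a_nb /IH{}IH; apply: reaches_step.
by rewrite /tm_step /= (negbTE sNH) s_right // rev_cons cat_rcons.
Qed.

Lemma step_put q a l i t : size (tr q a).2 <= N -> i <= size (tr q a).2 ->
  exists t', reaches (size (tr q a).2 - i).+1 (conf (Put q a i) l (blanks t))
    (go_left (tr q a).1 (rev (drop i (tr q a).2) ++ l) (blanks t')).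
Proof.
set w := (tr q a).2 => le_wN le_iw; move Dk: (size w - i) => k.
elim: k i l t le_iw Dk => [|k IH] i l t le_iw Dk.
  have -> : drop i w = [::] by apply: drop_oversize; lia.
  have w_i : i = size w by lia.
  exists t.-1.+1; apply: reaches_step; rewrite /tm_step /= inordK ?ltnS ?(leq_trans le_iw) //.
  rewrite head_blanks behead_blanks eqxx /= w_i ltnn; exact: reaches_refl.
have lt_iw : i < size w by rewrite -subn_gt0 Dk.
have Dk' : size w - i.+1 = k by rewrite subnS Dk.
have [t' IH'] := IH i.+1 (nth blank w i :: l) t.-1 lt_iw Dk'.
exists t'; apply: reaches_step; rewrite /tm_step /= inordK ?ltnS ?(leq_trans le_iw) //.
by rewrite head_blanks behead_blanks eqxx /= -/w lt_iw (drop_nth blank lt_iw) rev_cons cat_rcons.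
Qed.

Hypothesis tr_size : forall q a, size (tr q a).2 <= N.
Hypothesis tr_nonblank : forall q a, a != blank -> nonblank (tr q a).2.

Definition queue q w (c : config sweep_TM) :=
  exists j t, c = conf (Main q) (blanks j) (w ++ blanks t).

Definition sweeps t q w q' w' :=
  forall c, queue q w c -> exists2 c', queue q' w' c' & reaches t c c'.

Lemma sweeps_refl q w : sweeps 0 q w q w.
Proof. by move=> c cq; exists c => //; exact: reaches_refl. Qed.

Lemma sweeps_trans t1 t2 q1 w1 q2 w2 q3 w3 :
  sweeps t1 q1 w1 q2 w2 -> sweeps t2 q2 w2 q3 w3 -> sweeps (t1 + t2) q1 w1 q3 w3.
Proof.
move=> s1 s2 c1 /s1[c2 /s2[c3 c3q r2] r1]; exists c3 => //; exact: reaches_trans r1 r2.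
Qed.

Lemma sweeps_le t t' q w q' w' : t <= t' -> sweeps t q w q' w' -> sweeps t' q w q' w'.
Proof. by move=> le_tt' s c /s[c' c'q r]; exists c' => //; apply: reaches_le r. Qed.

(** One step pops, [size w] steps reach the end, at most N + 1 write, and at most [size w] + N + 1
    return. *)
Lemma sweeps1 q a w : q != qh -> nonblank (a :: w) ->
  sweeps (2 * size w + 2 * N + 3) q (a :: w) (tr q a).1 (w ++ (tr q a).2).
Proof.
move=> qNh; rewrite [all _ _]/= => /andP[a_nb w_nb] _ [j [t ->]].
have [t' put] := step_put (rev w ++ blanks j.+1) t (tr_size q a) (leq0n _).
have back := @step_back (tr q a).1 (w ++ (tr q a).2) (blanks t') j.+1.
have wo_nb : nonblank (w ++ (tr q a).2) by rewrite all_cat w_nb; exact: tr_nonblank.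
exists (conf (Main (tr q a).1) (blanks j.+1) ((w ++ (tr q a).2) ++ blanks t')).
  by exists j.+1, t'.
have le_t : (size w + ((size (tr q a).2 - 0).+1 + (size (w ++ (tr q a).2)).+1)).+1
    <= 2 * size w + 2 * N + 3.
  rewrite size_cat; have := tr_size q a.
  by move: (size (tr q a).2) (size w) => ? ?; lia.
apply: reaches_le le_t _; apply: reaches_step; rewrite /tm_step /= (negbTE qNh).
apply: reaches_trans.
  apply: (@step_right (Put q a 0) (blanks j.+1) w) => // b b_nb.
  by rewrite /= b_nb.
apply: reaches_trans put _; rewrite drop0 catA -rev_cat; exact: back.
Qed.

Fixpoint trun q u : Q * seq A :=
  if u is a :: u' then
    let: (q1, o) := tr q a in let: (q2, o') := trun q1 u' in (q2, o ++ o')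
  else (q, [::]).

Lemma trun_cat q u v :
  trun q (u ++ v) = ((trun (trun q u).1 v).1, (trun q u).2 ++ (trun (trun q u).1 v).2).
Proof.
elim: u q => [|a u IH] q /=; first by case: trun.
by case: tr => q1 o; rewrite IH; case: (trun q1 u) => q2 o' /=; rewrite catA.
Qed.

Lemma size_trun q u : size (trun q u).2 <= N * size u.
Proof.
elim: u q => [|a u IH] q //=; have := tr_size q a; case: tr => q1 o le_o.
by have := IH q1; case: trun => q2 o' /= le_o'; rewrite size_cat mulnS leq_add.
Qed.

Hypothesis tr_halt : forall q a, q != qh -> a != hash -> (tr q a).1 != qh.

(** The queue never exceeds [size w + N.+1 * size u], which bounds the cost of each pop. Only [hash]
    can lead to the halting phase, so the run is not cut short. *)
Lemma sweeps_trun q u w : q != qh -> nonblank u -> nonblank w -> hash \notin u ->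
  sweeps (size u * (2 * size w + 2 * (N.+1 * size u) + 2 * N + 3))
    q (u ++ w) (trun q u).1 (w ++ (trun q u).2).
Proof.
move=> qNh; elim: u q w qNh => [|a u IH] q w qNh; first by rewrite cats0 => *; exact: sweeps_refl.
move=> nb_au nb_w; rewrite inE negb_or eq_sym => /andP[aNh uNh].
have [a_nb u_nb] : a != blank /\ nonblank u by apply/andP.
have := sweeps1 qNh (_ : nonblank (a :: u ++ w)).
rewrite /= a_nb all_cat u_nb nb_w => /(_ isT) s1.
have le_o := tr_size q a.
have nb_o := tr_nonblank q a_nb.
have q1Nh := tr_halt qNh aNh.
move: s1 le_o nb_o q1Nh; case: (tr q a) => q1 o /= s1 le_o nb_o q1Nh.
have := IH q1 (w ++ o) q1Nh u_nb; rewrite all_cat nb_w nb_o => /(_ isT uNh).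
case: (trun q1 u) => q2 o' /= s2; rewrite -catA in s1.
rewrite -catA in s2; apply: sweeps_le (sweeps_trans s1 s2).
rewrite !size_cat; nia.
Qed.

Lemma trun_halt q u : q != qh -> hash \notin u -> (trun q u).1 != qh.
Proof.
elim: u q => [|a u IH] q //= qNh; rewrite inE negb_or eq_sym => /andP[aNh uNh].
have := tr_halt qNh aNh; case: (tr q a) => q1 o /= q1Nh.
by have := IH q1 q1Nh uNh; case: (trun q1 u).
Qed.

Lemma nonblank_trun q u : nonblank u -> nonblank (trun q u).2.
Proof.
elim: u q => [|a u IH] q //= /andP[a_nb u_nb].
have := tr_nonblank q a_nb; case: (tr q a) => q1 o /= o_nb.
by have := IH q1 u_nb; case: (trun q1 u) => q2 o' /= o'_nb; rewrite all_cat o_nb.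
Qed.

Lemma sweeps_pass q u : hash != blank -> q != qh -> nonblank u -> hash \notin u ->
  sweeps (10 * N.+1 * (size u).+1 ^ 2) q (rcons u hash)
    (tr (trun q u).1 hash).1 ((trun q u).2 ++ (tr (trun q u).1 hash).2).
Proof.
move=> hash_nb qNh u_nb uNh; have hash1_nb : nonblank [:: hash] by rewrite /= hash_nb.
have s1 := sweeps_trun qNh u_nb hash1_nb uNh.
have s2 : sweeps _ _ _ _ _ :=
  sweeps1 (trun_halt qNh uNh) (_ : nonblank (hash :: (trun q u).2)).
rewrite /= hash_nb nonblank_trun // in s2.
rewrite -cats1; apply: sweeps_le (sweeps_trans s1 (s2 isT)) => /=.
by have := size_trun q u; move: (size _) (size u) => x s le_x; nia.
Qed.

Definition bit_sym (b : bool) := if b then one else zero.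

(** Walking over [x], appending the marker, returning and finally halting take 2 |x| + 3 steps. The
    marker differs from both bits, so it stops [read_bits]. *)
Lemma sweep_TM_outputs t x y :
  [/\ blank != zero, blank != one & zero != one] -> hash != zero -> hash != one ->
  sweeps t q0 (rcons [seq bit_sym b | b <- x] hash) qh (rcons [seq bit_sym b | b <- y] hash) ->
  tm_outputs_within sweep_TM x (t + 2 * size x + 3) y.
Proof.
move=> [bz bo zo] hz ho sw; set bits := [seq bit_sym b | b <- x] in sw *.
have bits_nb : nonblank bits.
  by apply/allP=> a /mapP[b _ ->]; rewrite /bit_sym; case: b; rewrite eq_sym.
have sz : size bits = size x by rewrite size_map.
have right : reaches (size bits) (tm_init sweep_TM x) (conf Init (rev bits) [::]).
  have := @step_right Init [::] bits [::]; rewrite !cats0; apply=> // b.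
  by rewrite /= => /negbTE->.
have turn : reaches 1 (conf Init (rev bits) [::]) (go_left q0 (rev bits ++ blanks 0) [:: hash]).
  by apply: reaches_step; rewrite /tm_step /= eqxx cats0; exact: reaches_refl.
have back := step_back q0 [:: hash] 0 bits_nb.
have q_init : queue q0 (rcons bits hash) (conf (Main q0) (blanks 1) (bits ++ [:: hash])).
  by exists 1, 0; rewrite cats0 cats1.
have [c [j [k ->]] run] := sw _ q_init.
have fin : reaches 1 (conf (Main qh) (blanks j) (rcons [seq bit_sym b | b <- y] hash ++ blanks k))
   (conf Halt (blanks j) (rcons [seq bit_sym b | b <- y] hash ++ blanks k)).
  apply: reaches_step; rewrite /tm_step /= eqxx.
  by case: y {sw run} => [|b y]; exact: reaches_refl.
have [n le_n iterE] := reaches_trans right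
  (reaches_trans turn (reaches_trans back (reaches_trans run fin))).
exists n; first by apply: leq_trans le_n _; rewrite sz; lia.
rewrite iterE; split=> //; elim: y {sw run fin iterE} => [|b y IH] /=.
  by rewrite (negbTE ho) (negbTE hz).
by rewrite IH /bit_sym; case: b; rewrite eqxx // (negbTE zo).
Qed.

End Sweep.

(** * The transducer computing the reduction *)

(* [InputTok] is an input not yet counted, [GateTok] stands before a gate not yet
   counted, [Seed] is where the negations of the inputs of [C] are generated, and [Ref],
   [Out] end the unary references that still grow: a counted input adds 1 to the former
   and 2 to the latter, a counted gate adds 1 to the latter. *)
Inductive sym := Bit of bool | Blank | End | InputTok | GateTok | Ref | Out | Seed.

Definition sym_enum :=
  [:: Bit true; Bit false; Blank; End; InputTok; GateTok; Ref; Out; Seed].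

Definition sym_code a :=
  match a with
  | Bit true => 0 | Bit false => 1 | Blank => 2 | End => 3 | InputTok => 4
  | GateTok => 5 | Ref => 6 | Out => 7 | Seed => 8
  end.

Lemma sym_codeK : pcancel sym_code (onth sym_enum). Proof. by do 2?case. Qed.

HB.instance Definition _ := Countable.copy sym (pcan_type sym_codeK).

Lemma sym_enumP : Finite.axiom sym_enum. Proof. by do 2?case. Qed.

HB.instance Definition _ := isFinite.Build sym sym_enumP.

(* The first pass, in the [Read] phases, tokenises the input.  Each later pass starts in
   [Search] and consumes the first token that is left, continuing in [Bump] after an input and
   in [Count] after a gate; a pass without token leads to [Finish], which erases the marks. *)
Inductive phase :=
  ReadInputs | ReadGate | ReadOp | ReadRef1 | ReadRef2 | Search | Bump | Count | Finish | Done.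

Definition phase_enum :=
  [:: ReadInputs; ReadGate; ReadOp; ReadRef1; ReadRef2; Search; Bump; Count; Finish; Done].

Definition phase_code q :=
  match q with
  | ReadInputs => 0 | ReadGate => 1 | ReadOp => 2 | ReadRef1 => 3 | ReadRef2 => 4
  | Search => 5 | Bump => 6 | Count => 7 | Finish => 8 | Done => 9
  end.

Lemma phase_codeK : pcancel phase_code (onth phase_enum). Proof. by case. Qed.

HB.instance Definition _ := Countable.copy phase (pcan_type phase_codeK).

Lemma phase_enumP : Finite.axiom phase_enum. Proof. by case. Qed.

HB.instance Definition _ := isFinite.Build phase phase_enumP.

Definition num n t := rcons (nseq n (Bit true)) t.

Arguments num : simpl never.

Lemma numS n t : num n.+1 t = Bit true :: num n t. Proof. by []. Qed.

(** From the last three units of the input count p+3 through the first three gates of [reduction],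
    with [i] inputs of [C] counted. *)
Definition front i := num 3 (Bit false) ++ [:: Bit true] ++ num 1 (Bit false) ++
  [:: Bit false; Bit true] ++ num (3 + i) Ref ++ num (2 + i) Ref ++
  [:: Bit false; Bit false] ++ num 0 (Bit false) ++ num (4 + i) Ref.

(** The last gate of [reduction]. Its second reference p+5+[csize C] is 5+2p plus the number of
    gates, so an input adds 2 to it and a gate 1. *)
Definition rear i n := [:: Bit false; Bit false] ++ num (5 + i) Ref ++ num n Out.

(** Closing a reference of [C] with [num 6 Ref] adds the constant part of the offset p+6; the input
    passes add p. *)
Definition red_tr (q : phase) (a : sym) : phase * seq sym :=
  match q, a with
  | ReadInputs, Bit true => (ReadInputs, [:: InputTok])
  | ReadInputs, Bit false => (ReadGate, rcons (front 0) Seed)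
  | ReadGate, Bit true => (ReadRef1, [:: GateTok; Bit true])
  | ReadGate, Bit false => (ReadOp, [:: GateTok; Bit false])
  | ReadGate, End => (Search, rcons (rear 0 5) End)
  | ReadOp, Bit b => (ReadRef2, [:: Bit b])
  | ReadRef2, Bit false => (ReadRef1, num 6 Ref)
  | ReadRef1, Bit false => (ReadGate, num 6 Ref)
  | Search, InputTok => (Bump, [:: Bit true])
  | Search, GateTok => (Count, [::])
  | Search, End => (Finish, [:: End])
  | Bump, Ref => (Bump, num 1 Ref)
  | Bump, Out => (Bump, num 2 Out)
  | Bump, Seed => (Bump, Seed :: Bit true :: num 2 Ref)
  | Bump, End => (Search, [:: End])
  | Count, Out => (Count, num 1 Out)
  | Count, End => (Search, [:: End])
  | Finish, Ref => (Finish, [:: Bit false])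
  | Finish, Out => (Finish, [:: Bit false])
  | Finish, Seed => (Finish, [::])
  | Finish, End => (Done, [:: End])
  | _, _ => (q, [:: a])
  end.

(** 25 is the length of [rcons (front 0) Seed], the longest word pushed. *)
Definition red_TM := sweep_TM Blank (Bit false) (Bit true) End ReadInputs Done 25 red_tr.

Lemma red_tr_size q a : size (red_tr q a).2 <= 25. Proof. by case: q; case: a => // -[]. Qed.

Lemma red_tr_nonblank q a : a != Blank -> all (fun b => b != Blank) (red_tr q a).2.
Proof. by case: q; case: a => // -[]. Qed.

Lemma red_tr_halt q a : q != Done -> a != End -> (red_tr q a).1 != Done.
Proof. by case: q; case: a => // -[]. Qed.

Local Notation run := (trun red_tr).
Local Notation red_sweeps :=
  (@sweeps _ _ Blank (Bit false) (Bit true) End ReadInputs Done 25 red_tr).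

Definition inner : pred (seq sym) := all (fun a => (a != Blank) && (a != End)).

Lemma sweeps_red q u q' o : q != Done -> inner u -> 
  (red_tr (run q u).1 End) = (q', o) ->
  red_sweeps (10 * 26 * (size u).+1 ^ 2) q (rcons u End) q' ((run q u).2 ++ o).
Proof.
move=> qND; rewrite /inner all_predI => /andP[nb_u nE_u] E.
have -> : q' = (red_tr (run q u).1 End).1 by rewrite E.
have -> : o = (red_tr (run q u).1 End).2 by rewrite E.
apply: (sweeps_pass red_tr_size red_tr_nonblank red_tr_halt) => //.
by apply/negP => /(allP nE_u); rewrite eqxx.
Qed.

Definition image q u := flatten [seq (red_tr q a).2 | a <- u].

Lemma image_cat q u v : image q (u ++ v) = image q u ++ image q v.
Proof. by rewrite /image map_cat flatten_cat. Qed.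

Lemma run_stable q u : all (fun a => (red_tr q a).1 == q) u -> run q u = (q, image q u).
Proof.
elim: u => //= a u IH /andP[/eqP qa /IH]; rewrite /image /=.
by case: (red_tr q a) qa => q1 o /= -> ->.
Qed.

Lemma image_nseq q n a : (red_tr q a).2 = [:: a] -> image q (nseq n a) = nseq n a.
Proof. by move=> qa; elim: n => //= n IH; rewrite /image /= qa -/(image q _) IH. Qed.

Lemma image_num q n t k t' : (forall b, (red_tr q (Bit b)).2 = [:: Bit b]) ->
  (red_tr q t).2 = num k t' -> image q (num n t) = num (n + k) t'.
Proof.
move=> qb qt; rewrite /num -cats1 image_cat image_nseq // /image /= qt cats0 /num.
by rewrite -rcons_cat cat_nseq /ncons -iterD.
Qed.

Definition mark_gate t g :=
  match g with
  | GAnd j k => [:: Bit false; Bit false] ++ num j t ++ num k t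
  | GOr j k => [:: Bit false; Bit true] ++ num j t ++ num k t
  | GNot j => Bit true :: num j t
  end.

Lemma map_enc_nat n : map Bit (enc_nat n) = num n (Bit false).
Proof. by rewrite /enc_nat map_rcons map_nseq. Qed.

Lemma map_enc_gate g : map Bit (enc_gate g) = mark_gate (Bit false) g.
Proof. by case: g => * /=; rewrite ?map_cat !map_enc_nat. Qed.

Lemma inner_cat u v : inner (u ++ v) = inner u && inner v. Proof. exact: all_cat. Qed.

Lemma inner_num n t : inner (num n t) = inner [:: t].
Proof. by rewrite /num /inner all_rcons all_nseq orbT /= !andbT. Qed.

Lemma inner_gate t g : inner (mark_gate t g) = inner [:: t].
Proof. by case: g => * /=; rewrite ?inner_cat !inner_num ?andbb. Qed.

Lemma inner_flatten (I : Type) (f : I -> seq sym) s :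
  (forall i, inner (f i)) -> inner (flatten [seq f i | i <- s]).
Proof. by move=> fI; elim: s => //= i s IH; rewrite inner_cat fI. Qed.

(* Otherwise [image_cat] and [plain_cat] unify with [num]. *)
Opaque num.

Lemma image_cons q a u : image q (a :: u) = (red_tr q a).2 ++ image q u.
Proof. by []. Qed.

Lemma image_flatten q ss : image q (flatten ss) = flatten [seq image q u | u <- ss].
Proof. by elim: ss => //= u ss IH; rewrite image_cat IH. Qed.

Lemma image_flatten_map q (I : Type) (f g : I -> seq sym) s :
  (forall i, image q (f i) = g i) ->
  image q (flatten [seq f i | i <- s]) = flatten [seq g i | i <- s].
Proof. by move=> fg; rewrite image_flatten -map_comp; congr flatten; apply: eq_map. Qed.

(** * Tape contents between passes *)

Definition gates_tape (i : nat) (gs : seq gate) :=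
  flatten [seq GateTok :: mark_gate Ref (shift_gate (6 + i) g) | g <- gs].

Definition nots_tape i := flatten [seq mark_gate Ref (GNot j.+2) | j <- iota 0 i].

Definition body i gs := front i ++ Seed :: nots_tape i ++ gates_tape i gs ++ rear i (5 + i.*2).

Lemma run_read_gates gs :
  run ReadGate (map Bit (flatten [seq enc_gate g | g <- gs])) = (ReadGate, gates_tape 0 gs).
Proof.
Transparent num.
have ref1 n : run ReadRef1 (num n (Bit false)) = (ReadGate, num (6 + n) Ref).
  by rewrite addnC; elim: n => // n IH; rewrite addSn !numS /= IH.
have ref2 n : run ReadRef2 (num n (Bit false)) = (ReadRef1, num (6 + n) Ref).
  by rewrite addnC; elim: n => // n IH; rewrite addSn !numS /= IH.
have gateE g : run ReadGate (map Bit (enc_gate g)) =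
    (ReadGate, GateTok :: mark_gate Ref (shift_gate (6 + 0) g)).
  rewrite map_enc_gate; case: g => [j k|j k|j] /=; first 2 last.
  - by rewrite ref1.
  - by rewrite trun_cat ref2 /= ref1.
  - by rewrite trun_cat ref2 /= ref1.
elim: gs => // g gs IH; rewrite /= map_cat trun_cat gateE [(_, _).1]/= IH.
by [].
Qed.

Lemma run_read C :
  run ReadInputs (map Bit (enc_circuit C)) =
    (ReadGate, nseq (cin C) InputTok ++ rcons (front 0) Seed ++ gates_tape 0 (cgates C)).
Proof.
rewrite /enc_circuit map_cat map_enc_nat /num -cats1 -catA trun_cat.
have -> : run ReadInputs (nseq (cin C) (Bit true)) = (ReadInputs, nseq (cin C) InputTok).
  by elim: (cin C) => //= n ->.
by rewrite [(_, _).1]/= [(_, _).2]/= cat1s [trun _ _ _]/= run_read_gates.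
Qed.

Lemma bump_bit0 n : image Bump (num n (Bit false)) = num n (Bit false).
Proof. by rewrite (@image_num _ _ _ 0 (Bit false)) ?addn0. Qed.

Lemma bump_ref n : image Bump (num n Ref) = num n.+1 Ref.
Proof. by rewrite (@image_num _ _ _ 1 Ref) ?addn1. Qed.

Lemma bump_out n : image Bump (num n Out) = num n.+2 Out.
Proof. by rewrite (@image_num _ _ _ 2 Out) ?addn2. Qed.

Lemma bump_body i gs : image Bump (body i gs) = body i.+1 gs.
Proof.
have frontE : image Bump (front i) = front i.+1.
  by rewrite /front !(image_cat, image_cons, bump_bit0, bump_ref) /= !addnS.
(* The seed puts a fresh [GNot 2] in front of the older negations, each grown by 1, so the
   references 2 .. i+2 appear in order. *)
have notsE : (red_tr Bump Seed).2 ++ image Bump (nots_tape i) = Seed :: nots_tape i.+1.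
  rewrite /nots_tape (@image_flatten_map _ _ _ (fun j => mark_gate Ref (GNot j.+3))).
    by rewrite /= (iotaDl 1 0) -map_comp.
  by move=> j; rewrite /= image_cons bump_ref.
have gatesE : image Bump (gates_tape i gs) = gates_tape i.+1 gs.
  apply: image_flatten_map => g; rewrite image_cons /=; congr (_ :: _).
  by case: g => * /=; rewrite !(image_cons, image_cat, bump_ref) /= !addnS !addSn.
have rearE : image Bump (rear i (5 + i.*2)) = rear i.+1 (5 + i.+1.*2).
  by rewrite /rear !(image_cat, image_cons, bump_ref, bump_out) doubleS !addnS.
rewrite /body image_cat frontE image_cons image_cat (catA _ (image _ _)) notsE.
by rewrite image_cat gatesE rearE.
Qed.

Definition plain := all (fun a => a \in [:: Bit true; Bit false; Ref; Seed]).
Definition plain_or_tok := all (fun a => a \in [:: Bit true; Bit false; Ref; Seed; GateTok]).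

Definition quiet := all (fun a => a \in [:: Bit true; Bit false; Ref; Seed; Out]).

Lemma plain_quiet u : plain u -> quiet u.
Proof. by apply: sub_all => -[[]||||||| ]. Qed.

Lemma quiet_run_search u : quiet u -> run Search u = (Search, u).
Proof. by elim: u => //= a u IH /andP[]; case: a => //= [b|||] _ /IH ->. Qed.

Lemma plain_run_search u : plain u -> run Search u = (Search, u).
Proof. by move/plain_quiet/quiet_run_search. Qed.

Lemma plain_or_tok_count u : plain_or_tok u -> image Count u = u.
Proof. by elim: u => //= a u IH /andP[]; case: a => //= [b|||] _ /IH E; rewrite image_cons E. Qed.

Lemma plain_num n t : plain (num n t) = plain [:: t].
Proof. by rewrite /plain /num all_rcons all_nseq orbT /= !andbT. Qed.

Lemma plain_cat u v : plain (u ++ v) = plain u && plain v. Proof. exact: all_cat. Qed.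

Lemma plain_mark_gate g : plain (mark_gate Ref g).
Proof. by case: g => * /=; rewrite ?plain_cat !plain_num. Qed.

Lemma plain_flatten (I : Type) (f : I -> seq sym) s :
  (forall i, plain (f i)) -> plain (flatten [seq f i | i <- s]).
Proof. by move=> fI; elim: s => //= i s IH; rewrite plain_cat fI. Qed.

Lemma plain_front i : plain (front i).
Proof. by rewrite /front !(plain_cat, plain_num). Qed.

Lemma plain_nots_tape i : plain (nots_tape i).
Proof. by apply: plain_flatten => j; exact: plain_mark_gate. Qed.

Lemma quiet_rear i n : quiet (rear i n).
Proof. by rewrite /rear /num /quiet !(all_cat, all_rcons, all_nseq) !orbT. Qed.

Lemma plain_inner u : plain u -> inner u.
Proof. by apply: sub_all => -[[]||||||| ]. Qed.

Lemma inner_run q u : q \in [:: Bump; Count; Finish] -> inner u -> run q u = (q, image q u).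
Proof.
move=> q_in; rewrite /inner => u_in; apply: run_stable; apply: sub_all u_in => a.
by case: q q_in => //; case: a => // -[].
Qed.

Lemma inner_gates_tape i gs : inner (gates_tape i gs).
Proof. by apply: inner_flatten => g; rewrite -cat1s inner_cat inner_gate. Qed.

Lemma inner_nots_tape i : inner (nots_tape i).
Proof. by apply: inner_flatten => j; rewrite inner_gate. Qed.

Lemma inner_rear i n : inner (rear i n).
Proof. by rewrite /rear !(inner_cat, inner_num). Qed.

Lemma inner_body i gs : inner (body i gs).
Proof.
rewrite /body -(cat1s Seed).
by rewrite !(inner_gates_tape, inner_nots_tape, inner_rear, plain_inner (plain_front i),
             inner_cat).
Qed.

(** Every pass turns the first [InputTok] into a unit of the leading count. [S] bounds all
    intermediate tapes, so the passes share one cost. *)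
Lemma sweeps_inputs S k i gs :
  (forall j, j <= i + k -> i + k + size (body j gs) < S) ->
  red_sweeps (k * (10 * 26 * S ^ 2))
    Search (rcons (nseq i (Bit true) ++ nseq k InputTok ++ body i gs) End)
    Search (rcons (nseq (i + k) (Bit true) ++ body (i + k) gs) End).
Proof.
elim: k i => [|k IH] i leS; first by rewrite addn0; exact: sweeps_refl.
have plain_i : plain (nseq i (Bit true)) by rewrite /plain all_nseq orbT.
set u := nseq i (Bit true) ++ nseq k.+1 InputTok ++ body i gs.
have rest_in : inner (nseq k InputTok ++ body i gs).
  by rewrite inner_cat inner_body andbT /inner all_nseq orbT.
have runE : run Search u = (Bump, nseq i.+1 (Bit true) ++ nseq k InputTok ++ body i.+1 gs).
  rewrite /u trun_cat plain_run_search // [(_, _).1]/= [nseq k.+1 _ ++ _]/= [run Search _]/=.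
  rewrite inner_run //= image_cat image_nseq // bump_body.
  by congr pair; move: (body _ _) => s; elim: (i) => //= n ->.
have u_in : inner u.
  rewrite /u inner_cat (plain_inner plain_i) (inner_cat (nseq _ _)) inner_body.
  by rewrite /inner all_nseq orbT.
have := @sweeps_red Search u Search [:: End] isT u_in; rewrite runE => /(_ erefl) s1.
rewrite cats1 in s1; rewrite mulSn addnS -addSn.
apply: sweeps_trans (sweeps_le _ s1) _.
  rewrite leq_mul2l leq_exp2r // (leq_trans _ (leS i _)) ?leq_addr // ltnS.
  by rewrite /u !size_cat !size_nseq addnA.
by apply: IH => j; rewrite addSnnS; exact: leS.
Qed.

Lemma image_count_rear i n : image Count (rear i n) = rear i n.+1.
Proof.
rewrite /rear !image_cat (@image_num _ n _ 1 Out) // addn1.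
by rewrite (@image_num _ _ _ 0 Ref) // addn0.
Qed.

(** A pass deletes one [GateTok] and lengthens the [Out] reference by 1, so the queue keeps its
    length and one bound at the start suffices. Finished gates join [u]. *)
Lemma sweeps_gates S u i n gs : plain u ->
  size (u ++ gates_tape i gs ++ rear i n) < S ->
  red_sweeps (size gs * (10 * 26 * S ^ 2))
    Search (rcons (u ++ gates_tape i gs ++ rear i n) End)
    Search (rcons (u ++ flatten [seq mark_gate Ref (shift_gate (6 + i) g) | g <- gs] ++
                   rear i (n + size gs)) End).
Proof.
elim: gs u n => [|g gs IH] u n plain_u ltS; first by rewrite addn0; exact: sweeps_refl.
set m := mark_gate Ref (shift_gate (6 + i) g).
have tapeE : gates_tape i (g :: gs) = GateTok :: m ++ gates_tape i gs by [].
have pt_rest : plain_or_tok (m ++ gates_tape i gs).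
  rewrite /plain_or_tok all_cat; apply/andP; split.
    by apply: sub_all (plain_mark_gate _) => -[[]||||||| ].
  elim: (gs) => //= g' gs' IH'; rewrite all_cat -/(gates_tape _ _) IH' andbT.
  by apply: sub_all (plain_mark_gate _) => -[[]||||||| ].
have m_in : inner m by rewrite inner_gate.
have in_rest : inner (m ++ gates_tape i gs ++ rear i n).
  by rewrite !(m_in, inner_gates_tape, inner_rear, inner_cat).
set w := u ++ _ in ltS *.
have runE : run Search w = (Count, u ++ m ++ gates_tape i gs ++ rear i n.+1).
  rewrite /w tapeE trun_cat plain_run_search // [(_, _).1]/= [run Search _]/= -catA.
  rewrite inner_run //= catA image_cat plain_or_tok_count // image_count_rear.
  by rewrite -catA.
have w_in : inner w.
  by rewrite /w !(plain_inner plain_u, inner_gates_tape, inner_rear, inner_cat).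
have := @sweeps_red Search w Search [:: End] isT w_in; rewrite runE => /(_ erefl) s1.
rewrite cats1 in s1; rewrite /= mulSn -addSnnS -catA -/m catA.
apply: sweeps_trans (sweeps_le _ s1) _; first by rewrite leq_mul2l leq_exp2r.
rewrite [(_, _).2]/= (catA u m); apply: IH; first by rewrite plain_cat plain_u plain_mark_gate.
apply: leq_ltn_trans ltS; rewrite /w tapeE /rear /num !(size_cat, size_rcons, size_nseq) /=.
by rewrite !(size_cat, size_rcons, size_nseq); lia.
Qed.

Definition final_tape C :=
  let p := cin C in
  nseq p (Bit true) ++ front p ++ Seed :: nots_tape p ++
  flatten [seq mark_gate Ref (shift_gate (6 + p) g) | g <- cgates C] ++
  rear p (5 + p.*2 + size (cgates C)).

Lemma image_finish_gate g : image Finish (mark_gate Ref g) = map Bit (enc_gate g).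
Proof.
rewrite map_enc_gate; case: g => * /=; rewrite !(image_cons, image_cat) /=.
all: by rewrite !(@image_num _ _ _ 0 (Bit false)) // !addn0.
Qed.

Lemma image_finish_ref n : image Finish (num n Ref) = map Bit (enc_nat n).
Proof. by rewrite map_enc_nat (@image_num _ _ _ 0 (Bit false)) ?addn0. Qed.

Lemma image_finish_out n : image Finish (num n Out) = map Bit (enc_nat n).
Proof. by rewrite map_enc_nat (@image_num _ _ _ 0 (Bit false)) ?addn0. Qed.

Lemma image_finish_bit0 n : image Finish (num n (Bit false)) = map Bit (enc_nat n).
Proof. by rewrite map_enc_nat (@image_num _ _ _ 0 (Bit false)) ?addn0. Qed.

Lemma image_finish_gates (I : Type) (f : I -> gate) s :
  image Finish (flatten [seq mark_gate Ref (f i) | i <- s]) =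
  map Bit (flatten [seq enc_gate (f i) | i <- s]).
Proof.
rewrite (image_flatten_map _ (fun i => image_finish_gate (f i))).
by elim: s => //= i s ->; rewrite map_cat.
Qed.

Local Arguments enc_nat : simpl never.

Lemma image_finish C : image Finish (final_tape C) = map Bit (enc_circuit (reduction C)).
Proof.
rewrite /final_tape; set p := cin C; set s := size _.
(* The p units left by the input passes and the three of [front p] form the input count p+3. *)
have headE : nseq p (Bit true) ++ num 3 (Bit false) = num p.+3 (Bit false).
  by rewrite -[p.+3]addn3 /num nseqD rcons_cat.
rewrite /front !catA headE -!catA -(cat1s Seed).
rewrite !(image_finish_ref, image_finish_bit0, image_finish_gates, image_finish_out, image_cat).
have -> : 5 + p.*2 + s = 5 + p + csize C by rewrite /csize -/p -/s; lia.
rewrite /enc_circuit /reduction -/p [p + 6]addnC [p + 5]addnC.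
rewrite /= !(map_cat, flatten_cat) -!map_comp /= !map_cat /= cats0.
by rewrite -!catA /= !map_cat /= !map_cat.
Qed.

(** * Running time *)

Lemma size_mark_gate t g : size (mark_gate t g) = size (enc_gate g).
Proof.
rewrite -(size_map Bit) map_enc_gate.
by case: g => * /=; rewrite ?size_cat /num !size_rcons.
Qed.

Lemma size_enc_gate_shift d g : size (enc_gate (shift_gate d g)) <= size (enc_gate g) + d.*2.
Proof. by case: g => * /=; rewrite ?size_cat /enc_nat !size_rcons !size_nseq; lia. Qed.

Lemma size_flatten_le (I : eqType) (T : Type) (f : I -> seq T) b s :
  {in s, forall i, size (f i) <= b} -> size (flatten [seq f i | i <- s]) <= size s * b.
Proof.
elim: s => //= i s IH le_b; rewrite size_cat mulSn leq_add ?le_b ?mem_head //.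
by apply: IH => j j_s; rewrite le_b // inE j_s orbT.
Qed.

Lemma size_nots_tape i : size (nots_tape i) <= i * (i + 4).
Proof.
rewrite -{2}(size_iota 0 i); apply: size_flatten_le => j; rewrite mem_iota => /andP[_ lt_ji].
by rewrite /= /num size_rcons size_nseq; lia.
Qed.

Lemma size_gates_tape i gs : size (gates_tape i gs) <=
  size (flatten [seq enc_gate g | g <- gs]) + size gs * (13 + i.*2).
Proof.
elim: gs => //= g gs IH; rewrite size_cat -/(gates_tape i gs) size_mark_gate size_cat.
by have := size_enc_gate_shift (6 + i) g; rewrite /= in IH *; lia.
Qed.

Lemma size_enc_circuit C : size (enc_circuit C) =
  (cin C).+1 + size (flatten [seq enc_gate g | g <- cgates C]).
Proof. by rewrite /enc_circuit size_cat /enc_nat size_rcons size_nseq. Qed.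

Lemma size_gates_le gs : size gs <= size (flatten [seq enc_gate g | g <- gs]).
Proof.
elim: gs => //= g gs IH; rewrite size_cat -add1n leq_add //.
by case: g => * /=.
Qed.

(** Growth is quadratic: p negations of length at most p+4 appear, and each gate gains at most 2p+13
    symbols. *)
Definition tape_bound C := 60 * (size (enc_circuit C)).+1 ^ 2.

Lemma tape_lt C i m (p := cin C) (s := size (cgates C)) : i <= p -> m <= 5 + p.*2 + s ->
  p + size (front i ++ Seed :: nots_tape i ++ gates_tape i (cgates C) ++ rear i m) < tape_bound C.
Proof.
move=> le_ip le_m; rewrite /tape_bound size_enc_circuit -/p.
have := size_nots_tape i; have := size_gates_tape i (cgates C); have := size_gates_le (cgates C).
rewrite -/s !size_cat /= size_cat !size_cat.
rewrite /front /rear /num !(size_cat, size_rcons, size_nseq) /=.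
move: (size (nots_tape i)) (size (gates_tape _ _)) (size (flatten _)) => x y e le_s le_y le_x.
have le_x' : x <= p * (p + 4) by apply: leq_trans le_x _; rewrite leq_mul // leq_add2r.
have le_y' : y <= e + e * (13 + p.*2).
  by apply: leq_trans le_y _; rewrite leq_add2l leq_mul // leq_add2l leq_double.
nia.
Qed.

(** The passes are one for reading, one for each input and each gate, one search without a token,
    and the finish. *)
Lemma red_sweeps_all C :
  red_sweeps ((size (enc_circuit C) + 3) * (10 * 26 * tape_bound C ^ 2))
    ReadInputs (rcons (map Bit (enc_circuit C)) End)
    Done (rcons (map Bit (enc_circuit (reduction C))) End).
Proof.
set S := tape_bound C; set p := cin C; set gs := cgates C; set s := size gs.
have pass_le u : size u < S -> 10 * 26 * (size u).+1 ^ 2 <= 10 * 26 * S ^ 2.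
  by move=> lt_u; rewrite leq_mul2l leq_exp2r.
have s_read : red_sweeps (10 * 26 * S ^ 2) ReadInputs (rcons (map Bit (enc_circuit C)) End)
    Search (rcons (nseq 0 (Bit true) ++ nseq p InputTok ++ body 0 gs) End).
  have in_enc : inner (map Bit (enc_circuit C)) by rewrite /inner all_map; apply/allP=> -[].
  have := @sweeps_red ReadInputs _ Search (rcons (rear 0 5) End) isT in_enc.
  rewrite run_read => /(_ erefl) s1; rewrite /= /body.
  move: s1; rewrite [(_, _).2]/= -!catA cat_rcons -!rcons_cat => s1.
  by apply: sweeps_le s1; apply: pass_le; rewrite size_map /S /tape_bound; nia.
have s_inputs : red_sweeps (p * (10 * 26 * S ^ 2))
    Search (rcons (nseq 0 (Bit true) ++ nseq p InputTok ++ body 0 gs) End)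
    Search (rcons (nseq p (Bit true) ++ body p gs) End).
  by apply: sweeps_inputs => j le_jp; apply: (@tape_lt C) => //; lia.
pose u := nseq p (Bit true) ++ front p ++ Seed :: nots_tape p.
have u_plain : plain u.
  by rewrite /u -cat1s !(plain_front, plain_nots_tape, plain_cat) /plain all_nseq orbT.
have uE v : nseq p (Bit true) ++ front p ++ Seed :: nots_tape p ++ v = u ++ v.
  by rewrite /u -!catA.
have u_lt m : m <= 5 + p.*2 + s -> size (u ++ gates_tape p gs ++ rear p m) < S.
  move=> le_m; rewrite -uE size_cat size_nseq; exact: (@tape_lt C).
have s_gates := sweeps_gates u_plain (u_lt _ (leq_addr _ _)).
rewrite /body uE in s_inputs.
have finalE : final_tape C = u ++ flatten [seq mark_gate Ref (shift_gate (6 + p) g) | g <- gs] ++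
    rear p (5 + p.*2 + s) by rewrite /final_tape uE.
rewrite -finalE in s_gates.
have final_lt : size (final_tape C) < S.
  apply: leq_ltn_trans (u_lt _ (leqnn _)); rewrite finalE !size_cat leq_add2l leq_add2r.
  elim: (gs) => //= g gs' IH; rewrite !size_cat ltnW // ltnS leq_add2l; exact: IH.
have final_in : inner (final_tape C).
  rewrite finalE !(plain_inner u_plain, inner_rear, inner_cat) inner_flatten // => g.
  by rewrite inner_gate.
have s_search : red_sweeps (10 * 26 * S ^ 2) Search (rcons (final_tape C) End)
    Finish (rcons (final_tape C) End).
  have quiet_final : quiet (final_tape C).
    have quiet_cat v w : quiet (v ++ w) = quiet v && quiet w by exact: all_cat.
    rewrite finalE !(plain_quiet u_plain, quiet_rear, quiet_cat) andbT.
    by apply/plain_quiet/plain_flatten => g; exact: plain_mark_gate.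
  have := @sweeps_red Search _ Finish [:: End] isT final_in.
  rewrite quiet_run_search // cats1 => /(_ erefl); apply: sweeps_le; exact: pass_le.
have s_finish : red_sweeps (10 * 26 * S ^ 2) Finish (rcons (final_tape C) End)
    Done (rcons (map Bit (enc_circuit (reduction C))) End).
  have := @sweeps_red Finish _ Done [:: End] isT final_in.
  rewrite inner_run // image_finish cats1 => /(_ erefl); apply: sweeps_le.
  exact: pass_le.
apply: sweeps_le (sweeps_trans s_read (sweeps_trans s_inputs (sweeps_trans s_gates
  (sweeps_trans s_search s_finish)))).
rewrite -/s; have := size_gates_le gs; rewrite size_enc_circuit -/p -/gs -/s.
by move: (10 * 26 * S ^ 2) (size _) => K e; nia.
Qed.

Lemma polytime_reduction : polytime_circuit_map reduction.
Proof.
(* With n the input length, n+3 <= 4n passes and (n+1)^4 <= 16 n^4 in the squared tape bound give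
   the factor 64 and degree 5. The summand 5 absorbs 2n+3. *)
pose c := 64 * (10 * 26 * 60 ^ 2) + 5; exists red_TM, c, 5; split=> // C _.
have bitE : map Bit =1 map (bit_sym (Bit false) (Bit true)) by apply: eq_map => -[].
have := @red_sweeps_all C; rewrite !bitE /tape_bound.
set n := size (enc_circuit C) => sw.
have n_gt0 : 0 < n by rewrite /n size_enc_circuit.
have sym_neq : [/\ Blank != Bit false, Blank != Bit true & Bit false != Bit true] by [].
have [k le_k out] := sweep_TM_outputs sym_neq (isT : End != Bit false) (isT : End != Bit true) sw.
exists k => //; apply: leq_trans le_k (leq_trans _ (leq_addr _ _)); rewrite -/n.
have le4 : n.+1 ^ 4 <= 16 * n ^ 4.
  by rewrite -(expnMn 2 n 4) leq_exp2r // mul2n -addnn -addn1 leq_add2l.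
have le5 : n <= n ^ 5 by rewrite -{1}[n]expn1 leq_pexp2l.
rewrite expnMn -expnM /c; move: (10 * 26) (60 ^ 2) => a b.
have {}le4 : (n + 3) * (a * (b * n.+1 ^ 4)) <= 64 * (a * b) * n ^ 5.
  have -> : 64 * (a * b) * n ^ 5 = (4 * n) * (a * (b * (16 * n ^ 4))) by rewrite (expnS n 4); lia.
  by apply: leq_mul; [lia | rewrite !leq_mul2l le4 !orbT].
by move: le4; rewrite mulnDl; lia.
Qed.

Theorem theorem2 : exists T : circuit -> circuit, karp_reduction_CSAT_to_FSRIndec T.
Proof.
exists reduction; split=> [|C wfC]; first exact: polytime_reduction.
by split; [exact: wf_reduction | case: wfC => p_gt0 _; exact: satisfiable_reduction].
Qed.
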